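(* Let $h$ be a positive integer, let $A$ be an asymptotic basis with $G(A)\le h$, and let $X$ be a nonempty finite subset of $A$ such that $G(A\setminus X)<\infty$. Let $\mu=\mu(A,X)=\min_{y\in A\setminus X}\mathrm{diam}(X\cup\{y\})$. Then $$G(A\setminus X)\le 4h(2h\mu+1).$$
   Context: A set $A\subseteq\mathbb{Z}$ with $|A\cap\mathbb{Z}_{<0}|<\infty$ is an asymptotic basis if for some positive integer $h$ the $h$-fold sumset $hA=\{a_1+\dots+a_h: a_i\in A\}$ contains all but finitely many non-negative integers; the least such $h$ is the order $G(A)$ (and $G(A)=\infty$ if no such $h$ exists). For a finite set $Y$ of integers, $\mathrm{diam}(Y)=\max Y-\min Y$. *)

(* Defs.v *)
From Stdlib Require Import ZArith List Lia.
Import ListNotations.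
Open Scope Z_scope.

Definition fin_neg (A : Z -> Prop) : Prop :=
  exists l : list Z, forall a, A a -> a < 0 -> In a l.

Definition in_hsum (A : Z -> Prop) (h : nat) (n : Z) : Prop :=
  exists l : list Z, length l = h /\ Forall A l /\ fold_right Z.add 0 l = n.

Definition hsum_cofinite (A : Z -> Prop) (h : nat) : Prop :=
  exists N : Z, forall n, N <= n -> in_hsum A h n.

(* G(A) <= k : A is an asymptotic basis whose order (least positive h
   with hsum_cofinite A h) is at most k. *)
Definition order_le (A : Z -> Prop) (k : nat) : Prop :=
  fin_neg A /\ exists h : nat, (1 <= h)%nat /\ (h <= k)%nat /\ hsum_cofinite A h.

Definition order_finite (A : Z -> Prop) : Prop :=
  exists k : nat, order_le A k.

Definition setminus (A : Z -> Prop) (X : list Z) : Z -> Prop :=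
  fun a => A a /\ ~ In a X.

Definition diam_with (X : list Z) (y : Z) : Z :=
  fold_right Z.max y X - fold_right Z.min y X.

(* Main.v *)
(** Translate so that an element [y] of [A \ X] attaining [mu] becomes [0], put
    [B = A \ X - y], [C = hB] and [L = h mu]. Replacing by [0] the summands of an
    [h]-fold sum that lie in [X - y] moves the sum inside a fixed interval of
    length [L]; hence [C] meets every interval of [L + 1] consecutive large
    integers. Let [m_j] be the minimal number of elements of [jC] in a far away
    window of [2L + 2] consecutive integers. If [m_(j+1) = m_j], then near
    infinitely many [n] the translates of [jC] by the elements of [C] all agree
    with [jC] on such a window. Comparing two elements of [C] at distance
    [g <= L + 1], [jC] is eventually [g]-periodic; then it is eventually invariant
    under all of [C], hence under [1] because [C] is a basis, so [jC] is cofinite.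
    Otherwise [m_j] grows at every step, and [(2L + 2)C] is cofinite. *)
Require Import Defs.
From Stdlib Require Import ZArith List Lia Classical.
Open Scope Z_scope.

(** * Window counts and eventual periods *)

Definition cofinite (T : Z -> Prop) : Prop :=
  exists N : Z, forall n, N <= n -> T n.

Definition sumset (S T : Z -> Prop) : Z -> Prop :=
  fun z => exists s t, S s /\ T t /\ z = s + t.

Definition syndetic (L : Z) (C : Z -> Prop) : Prop :=
  exists N : Z, forall n, N <= n -> exists c, C c /\ n - L <= c <= n.

(** A lower bound on a cardinality is given by a duplicate-free list of witnesses, which spares
    counting an undecidable predicate. *)
Definition window_count_ge (T : Z -> Prop) (n w : Z) (m : nat) : Prop :=
  exists l : list Z, NoDup l /\ length l = m /\
    forall z, In z l -> T z /\ n - w < z <= n.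

Definition eventual_period (T : Z -> Prop) (p : Z) : Prop :=
  exists N : Z, forall x, N <= x -> (T x <-> T (x - p)).

Lemma window_count_full (T : Z -> Prop) (n w : Z) (m : nat) :
  0 < w -> w <= Z.of_nat m -> window_count_ge T n w m -> T n.
Proof.
  intros Hw Hm (l & Hnd & Hlen & Hl).
  set (I := map (fun i => n - Z.of_nat i) (seq 0 (Z.to_nat w))).
  assert (HI : incl I l).
  { apply NoDup_length_incl; [assumption | |].
    - unfold I. rewrite length_map, length_seq. lia.
    - intros z Hz. apply Hl in Hz as [_ Hz].
      apply in_map_iff. exists (Z.to_nat (n - z)).
      split; [lia|]. apply in_seq. lia. }
  apply (Hl n), HI, in_map_iff.
  exists 0%nat. split; [lia|]. apply in_seq. lia.
Qed.

(** Translating the [m] witnesses by [c] gives [m] elements of [T + C] in the window ending at [n].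
    A [z] outside these translates would be one more. *)
Lemma window_count_saturated (T C : Z -> Prop) (n w c : Z) (m : nat) :
  C c -> window_count_ge T (n - c) w m ->
  ~ window_count_ge (sumset T C) n w (S m) ->
  forall z, sumset T C z -> n - w < z <= n -> T (z - c).
Proof.
  intros Hc (l & Hnd & Hlen & Hl) Hsat z Hz Hzn.
  destruct (in_dec Z.eq_dec (z - c) l) as [Hin|Hout]; [now apply Hl|].
  exfalso. apply Hsat. exists (z :: map (fun t => t + c) l).
  split; [|split].
  - constructor.
    + intros Hin. apply in_map_iff in Hin as (t & Ht & Hin).
      apply Hout. now replace (z - c) with t by lia.
    + apply NoDup_map_NoDup_ForallPairs; [|assumption].
      intros s t _ _ Hst. lia.
  - simpl. now rewrite length_map, Hlen.
  - intros u [<-|Hu]; [now split|].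
    apply in_map_iff in Hu as (t & <- & Ht).
    destruct (Hl t Ht) as [HTt Htn]. split; [|lia].
    now exists t, c.
Qed.

Lemma period_iterate (T : Z -> Prop) (g N : Z) :
  (forall x, N <= x -> (T x <-> T (x - g))) ->
  0 <= g ->
  forall (q : nat) x, N <= x -> (T (x + Z.of_nat q * g) <-> T x).
Proof.
  intros Hper Hg q. induction q as [|q IH]; intros x Hx.
  - now replace (x + Z.of_nat 0 * g) with x by lia.
  - rewrite Hper by nia. rewrite <- (IH x Hx).
    now replace (x + Z.of_nat (S q) * g - g) with (x + Z.of_nat q * g) by lia.
Qed.

Lemma eventual_period_sum (T : Z -> Prop) (l : list Z) :
  Forall (eventual_period T) l -> eventual_period T (fold_right Z.add 0 l).
Proof.
  induction 1 as [|p l [N HN] _ [N' HN']]; simpl.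
  - exists 0. intros x _. now rewrite Z.sub_0_r.
  - exists (Z.max N (N' + p)). intros x Hx.
    rewrite (HN x), (HN' (x - p)) by lia.
    now replace (x - p - fold_right Z.add 0 l)
      with (x - (p + fold_right Z.add 0 l)) by lia.
Qed.

Lemma eventual_period_one_cofinite (T : Z -> Prop) :
  eventual_period T 1 -> (forall N, exists x, N <= x /\ T x) -> cofinite T.
Proof.
  intros [N HN] Hunb. destruct (Hunb N) as (x & Hx & HTx).
  exists x. intros n Hn.
  replace n with (x + Z.of_nat (Z.to_nat (n - x)) * 1) by lia.
  now apply (period_iterate T 1 N).
Qed.

(** Periods add up, so every large integer is a period; two consecutive ones, [K] and [K + 1], give
    period 1. *)
Lemma cofinite_of_basis_periods (T C : Z -> Prop) (k : nat) :
  hsum_cofinite C k -> (forall c, C c -> eventual_period T c) ->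
  (forall N, exists x, N <= x /\ T x) -> cofinite T.
Proof.
  intros [K HK] Hper Hunb.
  apply eventual_period_one_cofinite; [|assumption].
  assert (Hlarge : forall y, K <= y -> eventual_period T y).
  { intros y Hy. destruct (HK y Hy) as (l & _ & Hl & <-).
    apply eventual_period_sum. eapply Forall_impl; [exact Hper|exact Hl]. }
  destruct (Hlarge K ltac:(lia)) as [N HN].
  destruct (Hlarge (K + 1) ltac:(lia)) as [N' HN'].
  exists (Z.max N N' - K + Z.abs K + 1). intros x Hx.
  transitivity (T (x + K)).
  - rewrite (HN (x + K)) by lia. now replace (x + K - K) with x by lia.
  - rewrite (HN' (x + K)) by lia. now replace (x + K - (K + 1)) with (x - 1) by lia.
Qed.

Lemma window_count_step (C T : Z -> Prop) (L : Z) (k m : nat) :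
  0 <= L -> C 0 -> syndetic L C -> hsum_cofinite C k ->
  (forall N, exists x, N <= x /\ T x) ->
  (exists N, forall n, N <= n -> window_count_ge T n (2 * L + 2) m) ->
  cofinite T \/
  exists N, forall n, N <= n -> window_count_ge (sumset T C) n (2 * L + 2) (S m).
Proof.
  intros HL HC0 [N0 Hsyn] Hbasis Hunb [N1 Hcount].
  apply NNPP. intros Hno. apply not_or_and in Hno as [Hncof Hnstep].
  apply Hncof, (cofinite_of_basis_periods T C k); [assumption| |assumption].
  assert (Hgood : forall N, exists n, N <= n /\
            ~ window_count_ge (sumset T C) n (2 * L + 2) (S m)).
  { intros N. apply NNPP. intros H. apply Hnstep. exists N. intros n Hn.
    apply NNPP. intros H'. apply H. now exists n. }
  (* In a saturated window [T + C] coincides with [T + c] for each admissible [c]. As [0] is in [C],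
     both [T] and [T + c] equal [T + C] there. *)
  assert (Htrans : forall n c i, N1 <= n -> N1 <= n - c -> C c ->
            ~ window_count_ge (sumset T C) n (2 * L + 2) (S m) ->
            0 <= i < 2 * L + 2 -> (T (n - i) <-> T (n - c - i))).
  { intros n c i Hn Hnc Hc Hsat Hi. split; intros HT.
    - replace (n - c - i) with (n - i - c) by lia.
      apply (window_count_saturated T C n (2 * L + 2) c m); auto; [|lia].
      exists (n - i), 0. repeat split; auto; lia.
    - replace (n - i) with (n - i - 0) by lia.
      apply (window_count_saturated T C n (2 * L + 2) 0 m); auto; [| |lia].
      + apply Hcount. lia.
      + exists (n - c - i), c. repeat split; auto; lia. }
  (* [b] is sought in the [L + 1] integers just after [a], whence [0 < g <= L + 1]. *)
  destruct (Hsyn N0 ltac:(lia)) as (a & Ha & Ha').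
  destruct (Hsyn (a + 1 + L) ltac:(lia)) as (b & Hb & Hb').
  set (g := b - a).
  assert (Hg : 0 < g <= L + 1) by (unfold g; lia).
  assert (Hper : forall x, N1 <= x -> (T x <-> T (x - g))).
  { intros x Hx.
    (* The point [x] is carried by some [c] in [C] to [n - i] with [i <= L]. Passing through [b] and
       [a] moves it on to [n - (i + g)], still in the window because [i + g <= 2L + 1]; this fixes
       the window length [2L + 2]. *)
    destruct (Hgood (Z.max (Z.max N1 (x + N0)) (N1 + Z.max a b))) as (n & Hn & Hsat).
    destruct (Hsyn (n - x) ltac:(lia)) as (c & Hc & Hc').
    set (i := n - c - x).
    assert (Hi : 0 <= i <= L) by (unfold i; lia).
    transitivity (T (n - i)).
    { rewrite (Htrans n c i) by (auto; lia).
      now replace (n - c - i) with x by (unfold i; lia). }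
    transitivity (T (n - (i + g))).
    { rewrite (Htrans n b i), (Htrans n a (i + g)) by (auto; lia).
      now replace (n - a - (i + g)) with (n - b - i) by (unfold g; lia). }
    rewrite (Htrans n c (i + g)) by (auto; lia).
    now replace (n - c - (i + g)) with (x - g) by (unfold i; lia). }
  intros c Hc. exists (Z.max N1 (N1 + c)). intros x Hx.
  (* Adding the same multiple of [g] to [x] and [x - c] brings them to [n - i] and [n - c - i] with
     [i < g], where [Htrans] compares them. *)
  destruct (Hgood (x + Z.abs c)) as (n & Hn & Hsat).
  set (i := (n - x) mod g). set (q := Z.to_nat ((n - x) / g)).
  assert (Hi : 0 <= i < g) by (apply Z.mod_pos_bound; lia).
  assert (Hq : n - i = x + Z.of_nat q * g).
  { unfold q, i. rewrite Z2Nat.id by (apply Z.div_pos; lia).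
    pose proof (Z.div_mod (n - x) g ltac:(lia)). lia. }
  rewrite <- (period_iterate T g N1 Hper ltac:(lia) q x) by lia.
  rewrite <- (period_iterate T g N1 Hper ltac:(lia) q (x - c)) by lia.
  rewrite <- Hq. replace (x - c + Z.of_nat q * g) with (n - c - i) by lia.
  apply Htrans; auto; lia.
Qed.

(** * Iterated sumsets: padding, translation and growth *)

Lemma in_hsum_app (A : Z -> Prop) (j k : nat) (m n : Z) :
  in_hsum A j m -> in_hsum A k n -> in_hsum A (j + k) (m + n).
Proof.
  intros (l & Hl & HA & <-) (l' & Hl' & HA' & <-).
  exists (l ++ l'). split; [|split].
  - now rewrite length_app, Hl, Hl'.
  - now apply Forall_app.
  - clear. induction l as [|a l IH]; simpl; lia.
Qed.

Lemma in_hsum_zero (A : Z -> Prop) (k : nat) : A 0 -> in_hsum A k 0.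
Proof.
  intros HA. exists (repeat 0 k). split; [|split].
  - apply repeat_length.
  - apply Forall_forall. intros x Hx. now apply repeat_spec in Hx as ->.
  - induction k as [|k IH]; simpl; lia.
Qed.

Lemma in_hsum_le (A : Z -> Prop) (j k : nat) (n : Z) :
  A 0 -> (j <= k)%nat -> in_hsum A j n -> in_hsum A k n.
Proof.
  intros HA Hjk Hn. replace k with (j + (k - j))%nat by lia.
  replace n with (n + 0) by lia.
  apply in_hsum_app; [assumption|now apply in_hsum_zero].
Qed.

Lemma in_hsum_translate (A : Z -> Prop) (y : Z) (k : nat) (n : Z) :
  in_hsum (fun b => A (b + y)) k n <-> in_hsum A k (n + Z.of_nat k * y).
Proof.
  split; intros (l & <- & HA & Hn).
  - exists (map (fun b => b + y) l). split; [apply length_map|split].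
    + now apply Forall_map.
    + rewrite <- Hn. clear.
      induction l as [|a l IH]; simpl length; simpl fold_right; simpl map; lia.
  - exists (map (fun a => a - y) l). split; [apply length_map|split].
    + apply Forall_map. eapply Forall_impl; [|exact HA].
      intros a Ha. now replace (a - y + y) with a by lia.
    + enough (fold_right Z.add 0 (map (fun a => a - y) l)
              = fold_right Z.add 0 l - Z.of_nat (length l) * y) by lia.
      clear. induction l as [|a l IH]; simpl length; simpl fold_right; simpl map; lia.
Qed.

Lemma hsum_cofinite_translate (A : Z -> Prop) (y : Z) (k : nat) :
  hsum_cofinite (fun b => A (b + y)) k <-> hsum_cofinite A k.
Proof.
  split; intros [N HN].
  - exists (N + Z.of_nat k * y). intros n Hn.
    replace n with (n - Z.of_nat k * y + Z.of_nat k * y) by lia.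
    apply in_hsum_translate, HN. lia.
  - exists (N - Z.of_nat k * y). intros n Hn.
    apply in_hsum_translate, HN. lia.
Qed.

Lemma hsum_cofinite_of_syndetic (B : Z -> Prop) (h k : nat) (L : Z) :
  (1 <= h)%nat -> 0 <= L -> B 0 -> syndetic L (in_hsum B h) ->
  hsum_cofinite B k ->
  hsum_cofinite B (h * (2 * Z.to_nat L + 2)).
Proof.
  intros Hh HL HB0 Hsyn Hbasis.
  set (C := in_hsum B h).
  (* Padding with [0] puts [B] inside [C]. *)
  assert (HbasisC : hsum_cofinite C k).
  { destruct Hbasis as [N HN]. exists N. intros n Hn.
    destruct (HN n Hn) as (l & Hl & HBl & Hsum). exists l. repeat split; auto.
    eapply Forall_impl; [|exact HBl]. intros b Hb.
    apply (in_hsum_le B 1); auto. exists (b :: nil).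
    repeat split; [now constructor|simpl; lia]. }
  (* Each further copy of [C] adds one element to every late window, unless cofiniteness has already
     been reached, and padding preserves that. *)
  assert (Hinv : forall m : nat,
    cofinite (in_hsum B (h * S m)) \/
    exists N, forall n, N <= n ->
      window_count_ge (in_hsum B (h * S m)) n (2 * L + 2) (S m)).
  { induction m as [|m [[N HN]|IH]].
    - right. destruct Hsyn as [N HN]. exists N. intros n Hn.
      destruct (HN n Hn) as (c & Hc & Hcn). exists (c :: nil).
      split; [|split; [reflexivity|]].
      + constructor; [simpl; tauto|constructor].
      + intros z [<-|[]]. rewrite Nat.mul_1_r. split; [exact Hc|lia].
    - left. exists N. intros n Hn. apply (in_hsum_le B (h * S m)); auto; nia.
    - destruct (window_count_step C (in_hsum B (h * S m)) L k (S m))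
        as [[N HN]|[N HN]]; auto.
      + now apply in_hsum_zero.
      + intros N. destruct Hsyn as [N' HN'].
        destruct (HN' (Z.max N' (N + L)) ltac:(lia)) as (c & Hc & Hcn).
        exists c. split; [lia|]. apply (in_hsum_le B h); auto; nia.
      + left. exists N. intros n Hn. apply (in_hsum_le B (h * S m)); auto; nia.
      + right. exists N. intros n Hn.
        destruct (HN n Hn) as (l & Hnd & Hlen & Hl). exists l.
        repeat split; auto; try now apply Hl.
        destruct (Hl z H) as [(s & t & Hs & Ht & ->) _].
        replace (h * S (S m))%nat with (h * S m + h)%nat by lia.
        now apply in_hsum_app. }
  replace (2 * Z.to_nat L + 2)%nat with (S (2 * Z.to_nat L + 1)) by lia.
  destruct (Hinv (2 * Z.to_nat L + 1)%nat) as [H|[N HN]]; [exact H|].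
  (* A window of length [2L + 2] with [2L + 2] elements is full, so it contains [n]. *)
  exists N. intros n Hn. eapply window_count_full; [| |apply HN, Hn]; lia.
Qed.

(** * Removing [X] and the final bound *)

Lemma fold_min_max_bounds (X : list Z) (y : Z) :
  fold_right Z.min y X <= y <= fold_right Z.max y X /\
  forall x, In x X -> fold_right Z.min y X <= x <= fold_right Z.max y X.
Proof.
  induction X as [|a X [IHy IH]]; simpl.
  - split; [lia|tauto].
  - split; [lia|]. intros x [<-|Hx]; [lia|]. specialize (IH x Hx). lia.
Qed.

(** Each summand in [X] is exchanged for [y], at a cost in [[lo - y, hi - y]]; a summand that is
    kept costs [0], which also lies there. *)
Lemma in_hsum_replace (A : Z -> Prop) (X : list Z) (y lo hi : Z) (k : nat) (n : Z) :
  setminus A X y -> lo <= y <= hi -> (forall x, In x X -> lo <= x <= hi) ->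
  in_hsum A k n ->
  exists c, in_hsum (setminus A X) k c /\
    Z.of_nat k * (lo - y) <= n - c <= Z.of_nat k * (hi - y).
Proof.
  intros Hy Hlohi HX (l & <- & HA & <-).
  induction HA as [|a l Ha _ (c & Hc & Hcn)].
  - exists 0. split; [now exists nil|simpl; lia].
  - assert (Ha' : exists a', setminus A X a' /\ lo - y <= a - a' <= hi - y).
    { destruct (in_dec Z.eq_dec a X) as [Hin|Hout].
      - exists y. split; [assumption|]. specialize (HX a Hin). lia.
      - exists a. split; [now split|lia]. }
    destruct Ha' as (a' & Hsa' & Hdiff).
    exists (a' + c). split.
    + apply (in_hsum_app _ 1); [|assumption].
      exists (a' :: nil). repeat split; [now constructor|simpl; lia].
    + simpl length. simpl fold_right. lia.
Qed.

Lemma syndetic_of_replace (A : Z -> Prop) (X : list Z) (y : Z) (h : nat) :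
  setminus A X y -> hsum_cofinite A h ->
  syndetic (Z.of_nat h * diam_with X y)
    (in_hsum (fun b => setminus A X (b + y)) h).
Proof.
  intros Hy [N HN].
  destruct (fold_min_max_bounds X y) as [Hb HX].
  unfold diam_with in *.
  set (lo := fold_right Z.min y X) in *. set (hi := fold_right Z.max y X) in *.
  (* Starting from [n + h * lo] makes the possible values of [c - h * y] fill exactly
     [[n - h * (hi - lo), n]]. *)
  exists (N - Z.of_nat h * lo). intros n Hn.
  destruct (in_hsum_replace A X y lo hi h (n + Z.of_nat h * lo))
    as (c & Hc & Hcn); auto; [apply HN; lia|].
  exists (c - Z.of_nat h * y). split; [|lia].
  apply in_hsum_translate.
  now replace (c - Z.of_nat h * y + Z.of_nat h * y) with c by lia.
Qed.

Theorem theorem1p3 (A : Z -> Prop) (X : list Z) (h : nat) (mu : Z) :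
  (1 <= h)%nat ->
  order_le A h ->
  X <> nil ->
  (forall x, In x X -> A x) ->
  order_finite (setminus A X) ->
  (exists y, setminus A X y /\ diam_with X y = mu) ->
  (forall y, setminus A X y -> mu <= diam_with X y) ->
  order_le (setminus A X) (4 * h * (2 * h * Z.to_nat mu + 1)).
Proof.
  intros Hh [Hneg (h' & Hh'1 & Hh'h & HA)] _ _ (k0 & Hfin & k & _ & _ & HB)
    (y & Hy & Hmu) _.
  split; [assumption|].
  assert (Hmu0 : 0 <= mu).
  { rewrite <- Hmu. unfold diam_with. pose proof (fold_min_max_bounds X y). lia. }
  (* This is the growth bound with [L = h' * mu], that is [2h'(h' mu + 1)]; it increases with [h'],
     and [h' <= h]. *)
  exists (h' * (2 * Z.to_nat (Z.of_nat h' * mu) + 2))%nat.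
  rewrite Z2Nat.inj_mul, Nat2Z.id by lia.
  split; [nia|split].
  - assert (h' * Z.to_nat mu <= h * Z.to_nat mu)%nat by nia. nia.
  - apply (hsum_cofinite_translate _ y).
    replace (h' * Z.to_nat mu)%nat with (Z.to_nat (Z.of_nat h' * mu)) by lia.
    apply (hsum_cofinite_of_syndetic _ h' k); auto; [nia| |].
    + rewrite <- Hmu. now apply syndetic_of_replace.
    + now apply hsum_cofinite_translate.
Qed.
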